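(* There are infinitely many hypergraphs $H$ for which $$Z(IG(H)) = b_L(H)+|E(H)|-k,$$ where $k$ is the number of connected components of $H$ that contain at least one non-singleton hyperedge, $IG(H)$ is the incidence graph of $H$, $Z$ denotes the zero forcing number of a graph, and $b_L(H)$ is the lazy burning number of $H$.
   Context: All graphs are finite, undirected and simple; all hypergraphs are finite. ''Infinitely many'' is understood up to isomorphism. A hypergraph $H$ consists of a non-empty vertex set $V(H)$ and a collection $E(H)$ of subsets of $V(H)$, called hyperedges. A hyperedge containing exactly one vertex is called singleton; here a non-singleton hyperedge means one with at least two vertices. The connected components of $H$ are its maximal connected subhypergraphs: two vertices lie in the same component if and only if they are joined by a sequence of vertices in which consecutive vertices lie in a common hyperedge. A component contains a hyperedge if that hyperedge contains some vertex of the component. A component may have no hyperedges (an isolated vertex). The incidence graph $IG(H)$ is the bipartite graph with vertex set the disjoint union $V(H)\cup E(H)$ and edge set $\{vh \mid v\in V(H),\ h\in E(H),\ v\in h\}$. Lazy burning: a set $B\subseteq V(H)$ is chosen to be burned in the first round, and no other vertices are chosen later. In each later round, an unburned vertex $v$ becomes burned if and only if there is a non-singleton hyperedge $h\in E(H)$ with $v\in h$ such that all vertices of $h$ other than $v$ were burned at the end of the previous round. Burned vertices remain burned. $B$ is a lazy burning set if all vertices of $H$ eventually become burned. The lazy burning number $b_L(H)$ is the minimum cardinality of a lazy burning set of $H$. Zero forcing: in a graph $G$, a subset $B$ of vertices is initially blue and all other vertices are white. Color change rule: at each step, a blue vertex with exactly one white neighbor forces that neighbor to become blue. Vertices otherwise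 keep their color. $B$ is a zero forcing set if iterating the rule turns all of $V(G)$ blue. The zero forcing number $Z(G)$ is the minimum cardinality of a zero forcing set of $G$. *)

(* Defs.v *)
From mathcomp Require Import all_boot.

Set Implicit Arguments.
Unset Strict Implicit.
Unset Printing Implicit Defensive.

Record graph := Graph {
  gvert : finType;
  gedge : rel gvert;
  gedge_sym : symmetric gedge;
  gedge_irr : irreflexive gedge }.

Record hypergraph := Hypergraph {
  hvert : finType;
  hedges : {set {set hvert}};
  hvert_gt0 : 0 < #|hvert| }.

(* [eventually_all f B] iterates [f] exactly [#|T|] times; when [f] is         *)
(* inflationary this amounts to an unbounded number of rounds, see             *)
(* [eventually_allP].                                                          *)
Definition eventually_all (T : finType) (f : {set T} -> {set T}) (B : {set T}) :
  bool := iter #|T| f B == [set: T].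

Section Eventually.
Variables (T : finType) (f : {set T} -> {set T}).
Hypothesis f_infl : forall S : {set T}, S \subset f S.

Lemma iter_infl (B : {set T}) m n : m <= n -> iter m f B \subset iter n f B.
Proof.
move=> /subnK <-; elim: (n - m) => [|d IH] //.
by rewrite addSn iterS (subset_trans IH).
Qed.

Lemma infl_fix_or_grow (S : {set T}) : f S = S \/ #|S| < #|f S|.
Proof.
case: (eqVneq (f S) S) => [|neq]; [by left | right].
by apply: proper_card; rewrite properEneq eq_sym neq f_infl.
Qed.

Lemma iter_stable (B : {set T}) : f (iter #|T| f B) = iter #|T| f B.
Proof.
have key m : f (iter m f B) = iter m f B \/ m <= #|iter m f B|.
  elim: m => [|m [IH|IH]] /=; [by right | by left; rewrite !IH |].
  case: (infl_fix_or_grow (iter m f B)) => [E|lt]; first by left; rewrite !E.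
  by right; apply: leq_ltn_trans lt.
case: (key #|T|) => // le.
case: (infl_fix_or_grow (iter #|T| f B)) => // lt.
by have := leq_trans (leq_ltn_trans le lt) (max_card _); rewrite ltnn.
Qed.

Lemma eventually_allP (B : {set T}) :
  reflect (exists n, iter n f B = [set: T]) (eventually_all f B).
Proof.
apply: (iffP eqP) => [|[n En]]; first by exists #|T|.
apply/eqP; rewrite -subTset -En.
case: (leqP n #|T|) => [/iter_infl-> // | /ltnW/subnK<-].
by rewrite iterD iter_fix //; apply: iter_stable.
Qed.

Lemma eventually_allT : eventually_all f [set: T].
Proof. by apply/eventually_allP; exists 0. Qed.

End Eventually.

Definition white_neighbors (G : graph) (S : {set gvert G}) (u : gvert G) :
  {set gvert G} := [set w | gedge u w & w \notin S].

(* All forces available at a given step are performed simultaneously; the      *)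
(* final blue set does not depend on the order of the forces.                  *)
Definition zf_step (G : graph) (S : {set gvert G}) : {set gvert G} :=
  S :|: [set w | [exists u in S, white_neighbors S u == [set w]]].

Definition zero_forcing_set (G : graph) (B : {set gvert G}) : bool :=
  eventually_all (@zf_step G) B.

Lemma zero_forcing_setT (G : graph) : zero_forcing_set [set: gvert G].
Proof. by apply: eventually_allT => S; apply: subsetUl. Qed.

Definition zero_forcing_number (G : graph) : nat :=
  #|[arg min_(B < [set: gvert G] | zero_forcing_set B) #|B| ]|.

Definition burn_step (H : hypergraph) (S : {set hvert H}) : {set hvert H} :=
  S :|: [set v | [exists h in hedges H,
                    [&& 1 < #|h|, v \in h & h :\ v \subset S]]].

Definition lazy_burning_set (H : hypergraph) (B : {set hvert H}) : bool :=
  eventually_all (@burn_step H) B.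

Lemma lazy_burning_setT (H : hypergraph) : lazy_burning_set [set: hvert H].
Proof. by apply: eventually_allT => S; apply: subsetUl. Qed.

Definition lazy_burning_number (H : hypergraph) : nat :=
  #|[arg min_(B < [set: hvert H] | lazy_burning_set B) #|B| ]|.

Definition ig_vert (H : hypergraph) : finType :=
  (hvert H + {h : {set hvert H} | h \in hedges H})%type.

Definition ig_edge (H : hypergraph) : rel (ig_vert H) := fun x y =>
  match x, y with
  | inl v, inr h => v \in val h
  | inr h, inl v => v \in val h
  | _, _ => false
  end.

Lemma ig_edge_sym (H : hypergraph) : symmetric (@ig_edge H).
Proof. by move=> [v|h] [w|g]. Qed.

Lemma ig_edge_irr (H : hypergraph) : irreflexive (@ig_edge H).
Proof. by move=> [v|h]. Qed.

Definition incidence_graph (H : hypergraph) : graph :=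
  Graph (@ig_edge_sym H) (@ig_edge_irr H).

Definition hadj (H : hypergraph) : rel (hvert H) :=
  fun u v => [exists h in hedges H, (u \in h) && (v \in h)].

(* Components are represented by their vertex sets.                            *)
Definition components (H : hypergraph) : {set {set hvert H}} :=
  equivalence_partition (connect (@hadj H)) [set: hvert H].

Definition nontrivial_components (H : hypergraph) : {set {set hvert H}} :=
  [set C in components H |
    [exists h in hedges H, (1 < #|h|) && (h :&: C != set0)]].

Definition hypergraph_iso (H1 H2 : hypergraph) : Prop :=
  exists2 f : hvert H1 -> hvert H2, bijective f &
    forall A : {set hvert H1}, (f @: A \in hedges H2) = (A \in hedges H1).

Definition infinitely_many_hypergraphs (P : hypergraph -> Prop) : Prop :=
  exists F : nat -> hypergraph,
    (forall i, P (F i)) /\ (forall i j, hypergraph_iso (F i) (F j) -> i = j).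

(* Main.v *)
Require Import Defs.
From mathcomp Require Import all_boot all_order all_algebra.

(** Take the hypergraph on n + 2 vertices whose only hyperedge is the whole
    vertex set; its incidence graph is the star with n + 2 leaves.  Two unburned
    vertices block each other forever, and so do two white leaves of the star,
    while a single missing vertex or leaf is always recovered.  Hence
    both parameters equal n + 1, and |E| = k = 1. *)

Set Implicit Arguments.
Unset Strict Implicit.
Unset Printing Implicit Defensive.

(** Serves the lower bounds: a property of [B] kept by every round but false on the full set shows
    that [B] fails. *)
Lemma eventually_all_invariant (T : finType) (f : {set T} -> {set T})
    (P : pred {set T}) (B : {set T}) :
  (forall S, P S -> P (f S)) -> P B -> eventually_all f B -> P [set: T].
Proof. by move=> fP PB /eqP <-; elim: #|T| => //= m /fP. Qed.

Lemma card_arg_min_set (T : finType) (P : pred {set T}) (A B : {set T}) :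
  P A -> P B -> (forall S, P S -> #|B| <= #|S|) ->
  #|[arg min_(S < A | P S) #|S| ]| = #|B|.
Proof.
move=> PA PB Bmin; case: arg_minnP => // S PS Smin.
by apply/eqP; rewrite eqn_leq Smin // Bmin.
Qed.

Lemma card_missing_le1 (T : finType) (S : {set T}) :
  (forall x y, x \notin S -> y \notin S -> x = y) -> #|T|.-1 <= #|S|.
Proof.
move=> S_miss; rewrite -subn1 leq_subLR -(cardsC S) addnC leq_add2r.
by apply/card_le1_eqP => x y; rewrite !inE => xS yS; apply: S_miss.
Qed.

Section FullEdge.
Variable n : nat.

Let card_gt0 : 0 < #|'I_n.+2|. Proof. by rewrite card_ord. Qed.

(** With at least two vertices for every [n], the hyperedge is never singleton, so it can burn
    vertices and its component is counted by [k]. *)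
Definition full_edge : hypergraph :=
  @Hypergraph 'I_n.+2 [set [set: 'I_n.+2]] card_gt0.

(** The only hyperedge contains both [x] and [y], so neither can burn before the other: that both
    are unburned is an invariant. *)
Lemma lazy_burning_full_edge_miss (B : {set hvert full_edge}) x y :
  lazy_burning_set B -> x \notin B -> y \notin B -> x = y.
Proof.
move=> burnB xB yB; apply/eqP/negPn/negP => x_neq_y.
pose P (S : {set hvert full_edge}) := (x \notin S) && (y \notin S).
suff: P [set: hvert full_edge] by rewrite /P !inE.
apply: eventually_all_invariant burnB; last by rewrite /P xB.
move=> S /andP[xS yS].
have stuck v w : v != w -> v \notin S -> w \notin S -> w \notin burn_step S.
  move=> v_neq_w vS wS; rewrite !inE negb_or wS; apply/existsPn => h.
  rewrite inE; apply/negP => /and4P[/eqP-> _ _ /subsetP/(_ v)].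
  by rewrite !inE v_neq_w (negPf vS) => /(_ isT).
by rewrite /P (stuck y) 1?eq_sym // (stuck x).
Qed.

Lemma lazy_burning_full_edge_ord0 :
  @lazy_burning_set full_edge [set~ ord0].
Proof.
apply/eventually_allP; first by move=> S; apply: subsetUl.
exists 1; apply/setP => v; rewrite !inE /=.
case: eqP => //= ->; apply/existsP; exists [set: 'I_n.+2].
by rewrite !inE eqxx cardsT card_ord /= setTD.
Qed.

Lemma lazy_burning_number_full_edge : lazy_burning_number full_edge = n.+1.
Proof.
rewrite -[RHS](_ : #|[set~ ord0 : hvert full_edge]| = _); last first.
  by rewrite cardsC1 card_ord.
apply: card_arg_min_set.
- exact: lazy_burning_setT.
- exact: lazy_burning_full_edge_ord0.
move=> B burnB; rewrite cardsC1; apply: card_missing_le1 => x y.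
exact: lazy_burning_full_edge_miss.
Qed.

Let IG := incidence_graph full_edge.
Let leaf (v : hvert full_edge) : gvert IG := inl v.

Let leaf_inj : injective leaf. Proof. by move=> v w []. Qed.

Let edge_full (h : {h : {set hvert full_edge} | h \in hedges full_edge}) :
  val h = [set: hvert full_edge].
Proof. by apply/set1P; apply: valP. Qed.

(** Only the centre is adjacent to a leaf, and it forces nothing while it has two white
    neighbors. *)
Lemma zero_forcing_full_edge_miss (B : {set gvert IG}) x y :
  zero_forcing_set B -> leaf x \notin B -> leaf y \notin B -> x = y.
Proof.
move=> zfB xB yB; apply/eqP/negPn/negP => x_neq_y.
pose P (S : {set gvert IG}) := (leaf x \notin S) && (leaf y \notin S).
suff: P [set: gvert IG] by rewrite /P !inE.
apply: eventually_all_invariant zfB; last by rewrite /P xB.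
move=> S /andP[xS yS].
have stuck v w :
    v != w -> leaf v \notin S -> leaf w \notin S -> leaf w \notin zf_step S.
  move=> v_neq_w vS wS; rewrite !inE negb_or wS; apply/existsPn => u.
  apply/negP => /andP[_ /eqP/setP eq_w].
  (* Membership of [leaf w] shows that the forcing vertex [u] is the centre; then the white leaf
     [leaf v] is also among its white neighbors, so [v = w]. *)
  have := eq_w (leaf w); rewrite !inE eqxx wS andbT.
  case: u eq_w => // h eq_w _; have := eq_w (leaf v).
  by rewrite !inE /= vS edge_full inE (inj_eq leaf_inj) (negPf v_neq_w).
by rewrite /P (stuck y) 1?eq_sym // (stuck x).
Qed.

Lemma zero_forcing_full_edge_ord0 :
  @zero_forcing_set IG (leaf @: [set~ ord0]).
Proof.
set B := leaf @: _.
apply/eventually_allP; first by move=> S; apply: subsetUl.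
have leafB v : (leaf v \in B) = (v != ord0).
  by rewrite (mem_imset _ _ leaf_inj) !inE.
have centerB h : inr h \notin B by apply/imsetP => -[].
have centerS h : inr h \in zf_step B.
  (* As [ord_max] differs from [ord0], this leaf is blue; its only neighbor is the white centre. *)
  rewrite !inE; apply/orP; right; apply/existsP; exists (leaf ord_max).
  rewrite leafB; apply/eqP/setP => -[v|g]; rewrite !inE //=.
  by rewrite edge_full inE centerB; apply/esym/eqP; congr inr;
    apply: val_inj; rewrite !edge_full.
have leafS v : v != ord0 -> leaf v \in zf_step B.
  by move=> v_neq0; rewrite inE leafB v_neq0.
(* The first step colors the centre, and in the second the centre forces [leaf ord0]. *)
exists 2; rewrite /=; move: (zf_step B) centerS leafS => S centerS leafS.
apply/setP => -[v|h]; rewrite inE [RHS]inE; last by rewrite centerS.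
have [->|/leafS-> //] := eqVneq v ord0.
have [//|leaf0] := boolP (leaf ord0 \in S).
apply/orP; right; rewrite inE; apply/existsP.
exists (inr (exist _ [set: 'I_n.+2] (set11 _))); rewrite centerS /=.
apply/eqP/setP => -[w|g]; rewrite !inE //=.
have [->|w_neq0] := eqVneq w ord0; first by rewrite eqxx leaf0 inE.
by rewrite (leafS w) // andbF (inj_eq leaf_inj) (negPf w_neq0).
Qed.

Lemma zero_forcing_number_full_edge : zero_forcing_number IG = n.+1.
Proof.
have card0 : #|leaf @: [set~ ord0]| = n.+1.
  by rewrite card_imset // cardsC1 card_ord.
rewrite -[RHS]card0; apply: card_arg_min_set.
- exact: zero_forcing_setT.
- exact: zero_forcing_full_edge_ord0.
move=> B zfB; rewrite card0.
(* [B] may also contain the centre, so only its leaves are counted: at most one of the [n.+2] leaves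
   is missing. *)
have leB : #|leaf @: (leaf @^-1: B)| <= #|B|.
  by apply/subset_leq_card/subsetP => _ /imsetP[v + ->]; rewrite inE.
apply: leq_trans leB; rewrite card_imset //.
have := @card_missing_le1 _ (leaf @^-1: B); rewrite card_ord; apply=> x y.
by rewrite !inE; apply: zero_forcing_full_edge_miss.
Qed.

Lemma nontrivial_components_full_edge :
  nontrivial_components full_edge = [set [set: hvert full_edge]].
Proof.
have conn u v : connect (@hadj full_edge) u v.
  by apply: connect1; apply/existsP; exists [set: 'I_n.+2]; rewrite !inE eqxx.
have class v : [set w in [set: hvert full_edge] | connect (@hadj full_edge) v w]
    = [set: hvert full_edge].
  by apply/setP => w; rewrite !inE conn.
apply/setP => C; rewrite !inE; apply/andP/eqP => [[/imsetP[v _ ->] _] | ->].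
  exact: class.
split; first by apply/imsetP; exists ord0; rewrite ?class.
apply/existsP; exists [set: 'I_n.+2]; rewrite !inE eqxx cardsT card_ord setIT /=.
by apply/set0Pn; exists ord0.
Qed.

End FullEdge.

(** Separates the members of the family, since [full_edge n] has [n.+2] vertices. *)
Lemma hypergraph_iso_card (H1 H2 : hypergraph) :
  hypergraph_iso H1 H2 -> #|hvert H1| = #|hvert H2|.
Proof. by case=> f /bij_eq_card. Qed.

Local Open Scope ring_scope.

Theorem proposition3p5 :
  infinitely_many_hypergraphs (fun H : hypergraph =>
    (zero_forcing_number (incidence_graph H))%:Z =
    (lazy_burning_number H)%:Z + (#|hedges H|)%:Z
      - (#|nontrivial_components H|)%:Z).
Proof.
exists full_edge; split=> [n | n m /hypergraph_iso_card]; last first.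
  by rewrite !card_ord => -[].
rewrite zero_forcing_number_full_edge lazy_burning_number_full_edge.
by rewrite nontrivial_components_full_edge !cards1 GRing.addrK.
Qed.
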